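(* Fix $\alpha\in(0,1)$, and let $(\lambda_n)_{n\ge1}\subset(0,1)$ satisfy $\lambda_n\to0$ and $n\lambda_n\to\infty$ as $n\to\infty$. Let $(\Sigma_n)_{n\in\mathbb N}$ be a sequence of positive definite covariance matrices, $\Sigma_n\in\mathbb R^{n\times n}$, and let $\Delta_n>0$ be such that for all sufficiently large $n$ $$\Delta_n\sup_{I\in\mathcal I(\lambda_n)}\sqrt{\tilde\sigma_n(I)}\ \le\ (\sqrt2-\varepsilon_n)\sqrt{-\log\lambda_n},\qquad \tilde\sigma_n(I)=\mathbf 1_I^T\Sigma_n^{-1}\mathbf 1_I,$$ where $(\varepsilon_n)_{n\in\mathbb N}$ is a sequence satisfying $\varepsilon_n\to0$ and $\varepsilon_n\sqrt{-\log\lambda_n}\to\infty$ as $n\to\infty$. Assume in addition that for some $m\in\mathbb N_0$ $$\lim_{n\to\infty}\frac1{\lfloor\lambda_n^{-1}\rfloor^2}\sum_{\substack{I,I'\in\mathcal I^0\\ n|\inf I-\inf I'|>m}}\operatorname{Cov}\left(L_{I,\Delta_n},L_{I',\Delta_n}\right)=0 .$$ Then any sequence of tests $(\Phi_n)_{n\in\mathbb N}$ with $\limsup_{n\to\infty}\bar\alpha(\Phi_n)\le\alpha$ satisfies $\limsup_{n\to\infty}\bar\beta(\Phi_n)\ge1-\alpha$.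
   Context: The testing problem is $H_0:Y\sim\mathcal N_n(0,\Sigma_n)$ against $H_1^n:\exists I\in\mathcal I(\lambda_n),\exists\delta\in\mathbb R,|\delta|\ge\Delta_n$ with $Y\sim\mathcal N_n(\delta\mathbf 1_I,\Sigma_n)$. For an interval $I\subset[0,1]$, $\mathbf 1_I\in\mathbb R^n$ is the vector with entries $\mathbf 1_I(i)=1$ if $\frac in\in I$ and $0$ otherwise, $1\le i\le n$. For $\lambda\in(0,1)$, $\mathcal I(\lambda)=\{[a,b):0\le a<b\le1,\ b-a=\lambda\}$, and $\mathcal I^0=\{[(k-1)\lambda_n,k\lambda_n):1\le k\le\lfloor\lambda_n^{-1}\rfloor\}\subseteq\mathcal I(\lambda_n)$. A test is a (measurable) map $\Phi_n:\mathbb R^n\to\{0,1\}$. Let $\mathbb P_0$ and $\mathbb P_{I,\delta}$ denote the laws $\mathcal N_n(0,\Sigma_n)$ and $\mathcal N_n(\delta\mathbf 1_I,\Sigma_n)$ of $Y$. The errors are $\bar\alpha(\Phi_n)=\mathbb P_0[\Phi_n(Y)=1]$ and $\bar\beta(\Phi_n)=\sup_{I\in\mathcal I(\lambda_n)}\sup_{|\delta|\ge\Delta_n}\mathbb P_{I,\delta}[\Phi_n(Y)=0]$. The likelihood ratio between $\mathbb P_{I,\delta}$ and $\mathbb P_0$ is $L_{I,\delta}=\exp\left[\delta\mathbf 1_I^T\Sigma_n^{-1}Y-\frac12\delta^2\mathbf 1_I^T\Sigma_n^{-1}\mathbf 1_I\right]$, and covariances are taken under $\mathbb P_0$, so $\operatorname{Cov}(L_{I,\delta},L_{I',\delta})=\exp(\delta^2\mathbf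 1_I^T\Sigma_n^{-1}\mathbf 1_{I'})-1$. *)

(* Defs.v *)
From HB Require Import structures.
From mathcomp Require Import all_boot all_order all_algebra.
From mathcomp Require Import all_classical all_reals all_analysis.
From mathcomp Require Import measurable_realfun.

Set Implicit Arguments.
Unset Strict Implicit.
Unset Printing Implicit Defensive.

Import Order.TTheory GRing.Theory Num.Theory.
Import numFieldNormedType.Exports.

Local Open Scope classical_set_scope.
Local Open Scope ring_scope.

Definition posdef (R : realType) (n : nat) (S : 'M[R]_n) : Prop :=
  S^T = S /\ forall v : 'cV[R]_n, v != 0 -> 0 < (v^T *m S *m v) 0 0.

Lemma posdef_factor (R : realType) (n : nat) (S : 'M[R]_n) :
  posdef S -> exists A : 'M[R]_n, A *m A^T = S.
Proof.
elim: n S => [|n IH] S [Ssym Spos].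
  by exists 0; apply/matrixP => -[].
rewrite -[n.+1]/((1 + n)%N) in S Ssym Spos *.
pose a := ulsubmx S 0 0; pose b := dlsubmx S; pose D := drsubmx S.
have SE : S = block_mx a%:M b^T b D.
  rewrite -[LHS]submxK /a -mx11_scalar; congr block_mx.
  by rewrite /b trmx_dlsub Ssym.
have Dsym : D^T = D by rewrite /D trmx_drsub Ssym.
have a_gt0 : 0 < a.
  have := Spos (col_mx 1%:M 0).
  rewrite col_mx_eq0 oner_eq0 /= => /(_ isT).
  rewrite SE tr_col_mx trmx1 trmx0 mul_row_block !mul1mx !mul0mx !addr0.
  by rewrite mul_row_col mulmx0 addr0 mulmx1 mxE eqxx mulr1n.
have a_neq0 := lt0r_neq0 a_gt0.
pose T := D - a^-1 *: (b *m b^T).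
have [|A AE] := IH T.
  split; first by rewrite /T linearB /= linearZ /= trmx_mul trmxK Dsym.
  move=> w w0; have := Spos (col_mx (- a^-1 *: (b^T *m w)) w).
  rewrite col_mx_eq0 negb_and w0 orbT => /(_ isT).
  rewrite SE -mulmxA mul_block_col mul_scalar_mx scalerA mulrN mulfV// scaleN1r.
  rewrite addNr tr_col_mx mul_row_col mulmx0 add0r.
  by rewrite -scalemxAr -mulmxA /T mulmxBl -scalemxAl scaleNr addrC -(mulmxA b).
exists (block_mx (Num.sqrt a)%:M 0 ((Num.sqrt a)^-1 *: b) A).
have sa0 : Num.sqrt a != 0 by rewrite sqrtr_eq0 -ltNge.
rewrite tr_block_mx mulmx_block !tr_scalar_mx trmx0 !mulmx0 !mul0mx !addr0.
rewrite AE mul_scalar_mx scale_scalar_mx -expr2 sqr_sqrtr ?ltW//.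
rewrite linearZ /= mul_scalar_mx scalerA mulfV// scale1r mul_mx_scalar scalerA mulfV// scale1r.
by rewrite -scalemxAl -scalemxAr scalerA -invfM -expr2 sqr_sqrtr ?ltW// SE /T addrC subrK.
Qed.

(* R^n with its Borel sigma-algebra is [n.-tuple R], which carries the product
   sigma-algebra; [colt] moves to column vectors for the linear algebra. *)
Definition colt (R : realType) (n : nat) (y : n.-tuple R) : 'cV[R]_n :=
  \col_i tnth y i.

Section gaussian.
Context {R : realType}.

Definition consp (n : nat) (p : measurableTypeR R * n.-tuple R) : n.+1.-tuple R :=
  [the n.+1.-tuple R of p.1 :: p.2].

Lemma measurable_consp (n : nat) : measurable_fun setT (@consp n).
Proof.
apply: measurable_cons; last exact: measurable_snd.
by move=> mT Y mY; exact: measurable_fst.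
Qed.

HB.instance Definition _ (n : nat) :=
  isMeasurableFun.Build _ _ _ _ (@consp n) (@measurable_consp n).

(* The law of n independent N(0, 1) variables. *)
Fixpoint std_normal (n : nat) : probability (n.-tuple R) R :=
  match n with
  | 0 => \d_([tuple] : 0.-tuple R)
  | n'.+1 => distribution (normal_prob (0 : R) 1 \x std_normal n')%E (@consp n')
  end.

Definition affine (n : nat) (mu : 'cV[R]_n) (A : 'M[R]_n) (z : n.-tuple R) :
  n.-tuple R := [tuple (mu + A *m colt z) i 0 | i < n].

Lemma measurable_affine (n : nat) (mu : 'cV[R]_n) (A : 'M[R]_n) :
  measurable_fun setT (affine mu A).
Proof.
apply/measurable_fun_tnthP => i.
rewrite (_ : _ \o _ = fun z => mu i 0 + \sum_j A i j * tnth z j); last first.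
  apply/funext => z /=; rewrite tnth_mktuple !mxE; congr (_ + _).
  by apply: eq_bigr => j _; rewrite mxE.
apply: measurable_funD; first exact: measurable_cst. apply: measurable_sum => j.
by apply: measurable_funM => //; exact: measurable_tnth.
Qed.

HB.instance Definition _ (n : nat) (mu : 'cV[R]_n) (A : 'M[R]_n) :=
  isMeasurableFun.Build _ _ _ _ (affine mu A) (@measurable_affine n mu A).

Definition sqrt_factor (n : nat) (S : 'M[R]_n) : 'M[R]_n :=
  xget 0 [set A : 'M[R]_n | A *m A^T = S].

Lemma sqrt_factorP (n : nat) (S : 'M[R]_n) :
  posdef S -> sqrt_factor S *m (sqrt_factor S)^T = S.
Proof. by move=> /posdef_factor; exact: xgetPex. Qed.

(* N_n(mu, S), as the law of mu + A Z with A A^T = S and Z standard normal in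
   R^n; the law does not depend on the choice of A. *)
Definition mvnormal (n : nat) (mu : 'cV[R]_n) (S : 'M[R]_n) :
    probability (n.-tuple R) R :=
  distribution (std_normal n) (affine mu (sqrt_factor S)).

End gaussian.

Section testing.
Context {R : realType}.
Implicit Types (I : set R) (lam delta Delta : R) (n : nat).

Definition intervals lam : set (set R) :=
  [set I | exists a b : R,
    [/\ 0 <= a, a < b, b <= 1, b - a = lam & I = `[a, b[%classic]].

(* The entries are indexed from 0, so entry i sits at the point (i + 1) / n. *)
Definition ind n I : 'cV[R]_n := \col_(i < n) (i.+1%:R / n%:R \in I)%:R.

Definition sigtilde n (S : 'M[R]_n) I : R :=
  ((ind n I)^T *m invmx S *m ind n I) 0 0.

Definition lik_ratio n (S : 'M[R]_n) I delta (y : n.-tuple R) : R :=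
  expR (delta * ((ind n I)^T *m invmx S *m colt y) 0 0
        - 2^-1 * delta ^+ 2 * sigtilde S I).

Definition P0 n (S : 'M[R]_n) : probability (n.-tuple R) R := mvnormal 0 S.

Definition P1 n (S : 'M[R]_n) I delta : probability (n.-tuple R) R :=
  mvnormal (delta *: ind n I) S.

(* The intervals of I^0 are [itv0 lam k] for k < truncn lam^-1 (k starts at 0);
   they are pairwise distinct when lam > 0. *)
Definition itv0 lam (k : nat) : set R := `[k%:R * lam, k.+1%:R * lam[%classic.

(* A test takes the value [true] when it rejects the null hypothesis. *)
Definition err1 n (S : 'M[R]_n) (Phi : n.-tuple R -> bool) : \bar R :=
  P0 S [set y | Phi y = true].

Definition err2 n (S : 'M[R]_n) lam Delta (Phi : n.-tuple R -> bool) : \bar R :=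
  ereal_sup [set ereal_sup [set P1 S I delta [set y | Phi y = false]
                           | delta in [set delta | Delta <= `|delta|]]
            | I in intervals lam].

Definition avg_cov n (S : 'M[R]_n) lam Delta (m : nat) : \bar R :=
  (((Num.truncn lam^-1)%:R ^- 2)%:E *
   \sum_(k < Num.truncn lam^-1)
     \sum_(l < Num.truncn lam^-1 |
           (m%:R < n%:R * `|inf (itv0 lam k) - inf (itv0 lam l)|)%R)
       covariance (P0 S) (lik_ratio S (itv0 lam k) Delta)
                         (lik_ratio S (itv0 lam l) Delta))%E.

End testing.

(* Main.v *)
Require Import Defs.
From mathcomp Require Import all_boot all_order all_algebra.
From mathcomp Require Import all_classical all_reals all_analysis.
From mathcomp Require Import measurable_realfun ring lra.

(** The worst-case type II error at scale [lam] is at least the average of the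
    type II errors over the [K = truncn lam^-1] disjoint intervals of length
    [lam], all taken at amplitude [Delta].  By a change of measure this average
    is the integral of [Lbar] over the acceptance region under the null
    hypothesis, where [Lbar] is the mean of the [K] likelihood ratios [L_k].
    Hence the sum of the two errors is at least [1 - E|Lbar - 1|] ([E] being
    the expectation under the null hypothesis), and it suffices that [Lbar]
    converge to 1 in [L^1].

    It need not converge in [L^2]: at the boundary
    [Delta ^+ 2 * sigtilde S I ~ 2 * - ln lam] the diagonal terms [E L_k ^+ 2]
    may be as large as [lam ^- 2], which the factor [K ^- 2] only just
    compensates one at a time, while there are [K] of them.  So each [L_k] is
    truncated at a level [tau] of smaller order than [K].
    With [l = - ln lam] and [e = eps / sqrt 2], the hypothesis reads
    [Delta ^+ 2 * sigtilde S I <= 2 * (1 - e) ^+ 2 * l], and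
    [tau = expR (l * (1 - e / 2))] does everything:
    - the truncated diagonal contributes at most
      [tau / K <= 2 * expR (- (e * l / 2))] once [lam <= 1 / 2];
    - the mass lost is at most
      [tau `^ (- e) * E (L_k `^ (1 + e)) <= expR (- (e ^+ 2 * l / 2))],
      by the explicit moments of a log-normal variable;
    - off the diagonal truncation can only decrease [E (L_k * L_j)], so the
      covariance hypothesis bounds what remains; there [n * |inf I - inf I'| > m]
      amounts to [I <> I'] as soon as [n * lam > m].
    Both exponentials tend to 0 because [e ^+ 2 * l = (eps * sqrt l) ^+ 2 / 2]
    tends to infinity.

    Truncation and the bound on [E|Lbar - 1|] are packed into a single pointwise
    inequality between polynomials in the [L_k] ([mixture_pointwise]), so that
    only nonnegative functions are ever integrated ([mixture_integral]).  The
    Gaussian input is the translation formula for the standard normal law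
    ([std_normal_shift], by induction on the dimension), which gives the density
    of [mvnormal mu S] with respect to [mvnormal 0 S] ([mvnormal_density]) and
    from it the Laplace transform ([mvnormal_mgf]). *)

Set Implicit Arguments.
Unset Strict Implicit.
Unset Printing Implicit Defensive.

Import Order.TTheory GRing.Theory Num.Theory.
Import numFieldNormedType.Exports.

Local Open Scope classical_set_scope.
Local Open Scope ring_scope.

(** * Translations of Gaussian measures *)

Lemma lebesgue_measure_shift (R : realType) (h : R) (A : set R) : measurable A ->
  pushforward lebesgue_measure ((fun x => h + x) : _ -> measurableTypeR R) A
  = lebesgue_measure A.
Proof.
move=> mA; apply/esym.
pose g : measurableTypeR R -> measurableTypeR R := fun x => h + x.
have mg : measurable_fun setT g by exact: measurable_funD.
pose nu : {measure set (measurableTypeR R) -> \bar R} :=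
  pushforward lebesgue_measure g.
suff nuE (X : set (measurableTypeR R)) : ocitv X -> lebesgue_measure X = nu mg X.
  exact: (@lebesgue_measure_unique R (nu mg) nuE A mA).
move=> [[a b] _ <-].
rewrite /nu /= /pushforward.
rewrite (_ : g @^-1` _ = `](a - h), (b - h)]%classic :> set R); last first.
  apply/seteqP; split=> x /=; rewrite /g !in_itv/= => /andP[p q]; apply/andP; split; lra.
rewrite !lebesgue_measure_itv/= !lte_fin ltrD2r.
by case: ifP => // _; rewrite -!EFinD; congr EFin; lra.
Qed.

(** The law is defined by integrating its density over sets; that density agrees
    almost everywhere with the Radon-Nikodym derivative, for which the change of
    variables is available for all nonnegative functions. *)
Lemma ge0_integral_normal_prob (R : realType) (m s : R) (f : R -> \bar R) :
  measurable_fun setT f -> (forall x, 0 <= f x)%E ->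
  (\int[normal_prob m s]_x f x =
   \int[lebesgue_measure]_x (f x * (normal_pdf m s x)%:E))%E.
Proof.
move=> mf f0.
have dom := @normal_prob_dominates R m s.
rewrite -(Radon_Nikodym_SigmaFinite.change_of_variables dom)//.
apply: ae_eq_integral => //.
- apply: emeasurable_funM => //; apply: (measurable_int lebesgue_measure).
  exact: Radon_Nikodym_SigmaFinite.f_integrable.
- apply: emeasurable_funM => //=; apply/measurableT_comp => //=.
  exact: measurable_normal_pdf.
- apply: ae_eqe_mul2l => /=.
  apply: integral_ae_eq => //=.
  + exact: Radon_Nikodym_SigmaFinite.f_integrable.
  + by apply/measurable_funTS/measurableT_comp =>//; exact: measurable_normal_pdf.
  + by move=> E _ mE; rewrite -Radon_Nikodym_SigmaFinite.f_integral.
Qed.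

(** The density at [x - h] is the density at [x] times
    [expR (h * x - h ^+ 2 / 2)]: complete the square. *)
Lemma normal_prob_shift (R : realType) (h : R) (f : R -> \bar R) :
  measurable_fun setT f -> (forall x, 0 <= f x)%E ->
  (\int[normal_prob (0:R) 1]_x f (h + x)%R =
   \int[normal_prob (0:R) 1]_x (f x * (expR (h * x - 2^-1 * h ^+ 2))%:E))%E.
Proof.
move=> mf f0.
have mfh : measurable_fun [set: R] (fun x => f (h + x)).
  by apply: (measurableT_comp mf); exact: measurable_funD.
have mE : measurable_fun [set: R] (fun x => (expR (h * x - 2^-1 * h ^+ 2))%:E).
  apply/measurable_EFinP/measurableT_comp => //.
  by apply: measurable_funB => //; exact: measurable_funM.
rewrite !ge0_integral_normal_prob//; last 2 first.
- exact: emeasurable_funM.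
- by move=> x; rewrite mule_ge0// lee_fin expR_ge0.
pose G y := (f y * (normal_pdf 0 1 (y - h))%:E)%E.
have mG : measurable_fun [set: measurableTypeR R] G.
  apply: emeasurable_funM => //; apply/measurable_EFinP.
  apply: measurableT_comp; first exact: measurable_normal_pdf.
  exact: measurable_funB.
pose g : measurableTypeR R -> measurableTypeR R := fun x => h + x.
have mg : measurable_fun setT g by exact: measurable_funD.
transitivity (\int[pushforward lebesgue_measure g]_x G x)%E.
  have G0 : {in [set: measurableTypeR R], forall y, (0 <= G y)%E}.
    by move=> y _; rewrite /G mule_ge0// lee_fin normal_pdf_ge0.
  rewrite (ge0_integral_pushforward mg _ measurableT mG G0).
  by apply: eq_integral => x _; rewrite /G /g /= addrAC subrr add0r.
rewrite (eq_measure_integral lebesgue_measure); last first.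
  by move=> A mA _; exact: lebesgue_measure_shift.
apply: eq_integral => x _; rewrite /G -muleA -EFinM; congr (_ * _%:E)%E.
rewrite !normal_pdfE ?oner_neq0//= mulrCA; congr (_ * _).
rewrite /normal_fun -expRD; congr expR.
rewrite expr1n !subr0; by field.
Qed.

Lemma ge0_integral_std_normalS (R : realType) (n : nat) (f : n.+1.-tuple R -> \bar R) :
  measurable_fun setT f -> (forall z, 0 <= f z)%E ->
  (\int[std_normal n.+1]_z f z =
   \int[normal_prob (0:R) 1]_x \int[std_normal n]_z f [tuple of x :: z])%E.
Proof.
move=> mf f0; rewrite /= ge0_integral_distribution//.
rewrite fubini_tonelli1//.
  exact: (measurableT_comp mf (@measurable_consp R n)).
by move=> p; exact: f0.
Qed.

Definition shift_tuple (R : realType) (n : nat) (h : 'I_n -> R) (z : n.-tuple R) :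
  n.-tuple R := [tuple h i + tnth z i | i < n].

Lemma measurable_shift_tuple (R : realType) (n : nat) (h : 'I_n -> R) :
  measurable_fun setT (shift_tuple h).
Proof.
apply/measurable_fun_tnthP => i.
rewrite (_ : _ \o _ = fun z => h i + tnth z i); last first.
  by apply/funext => z /=; rewrite tnth_mktuple.
by apply: measurable_funD => //; exact: measurable_tnth.
Qed.

Lemma measurable_tilt (R : realType) (n : nat) (h : 'I_n -> R) (c : R) :
  measurable_fun setT (fun z : n.-tuple R =>
    (expR (\sum_i h i * tnth z i - c))%:E).
Proof.
apply/measurable_EFinP/measurableT_comp => //.
apply: measurable_funB => //; apply: measurable_sum => i.
by apply: measurable_funM => //; exact: measurable_tnth.
Qed.

(** Cameron-Martin formula: translations act coordinatewise, so the
    one-dimensional formula is applied to the first coordinate and the induction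
    hypothesis to the others, under Tonelli's theorem. *)
Lemma std_normal_shift (R : realType) (n : nat) (h : 'I_n -> R)
  (f : n.-tuple R -> \bar R) :
  measurable_fun setT f -> (forall z, 0 <= f z)%E ->
  (\int[std_normal n]_z f (shift_tuple h z) =
   \int[std_normal n]_z
     (f z * (expR (\sum_i h i * tnth z i - 2^-1 * \sum_i h i ^+ 2))%:E))%E.
Proof.
elim: n h f => [|n IH] h f mf f0.
  apply: eq_integral => z _; rewrite !big_ord0 mulr0 subrr expR0 mule1.
  by congr f; rewrite tuple0 [RHS]tuple0.
have msf := measurableT_comp mf (measurable_shift_tuple h).
have mft : measurable_fun setT (fun z => f z *
    (expR (\sum_i h i * tnth z i - 2^-1 * \sum_i h i ^+ 2))%:E)%E.
  by apply: emeasurable_funM => //; exact: measurable_tilt.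
have ft0 z : (0 <= f z *
    (expR (\sum_i h i * tnth z i - 2^-1 * \sum_i h i ^+ 2))%:E)%E.
  by rewrite mule_ge0// lee_fin expR_ge0.
rewrite (ge0_integral_std_normalS msf (fun z => f0 _)).
rewrite (ge0_integral_std_normalS mft ft0).
(* [F x] integrates out the last [n] coordinates once they have been shifted. *)
pose h' (i : 'I_n) := h (lift ord0 i).
pose T (z : n.-tuple R) := expR (\sum_i h' i * tnth z i - 2^-1 * \sum_i h' i ^+ 2).
pose F x := (\int[std_normal n]_z (f [tuple of x :: z] * (T z)%:E))%E.
have mcons (x : R) : measurable_fun setT (fun z : n.-tuple R => [tuple of x :: z]).
  exact: measurable_cons.
have mfT : measurable_fun setT (fun p : measurableTypeR R * n.-tuple R =>
    f (consp p) * (T p.2)%:E)%E.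
  apply: emeasurable_funM.
    by apply: (measurableT_comp mf); exact: measurable_consp.
  by apply: (measurableT_comp (measurable_tilt h' _)); exact: measurable_snd.
have mfx (x : R) : measurable_fun setT (fun z : n.-tuple R => f [tuple of x :: z] * (T z)%:E)%E.
  apply: emeasurable_funM; first exact: (measurableT_comp mf).
  exact: (measurable_tilt h' _).
have mF : measurable_fun setT F.
  apply: (measurable_fun_fubini_tonelli_F _ mfT) => p.
  by rewrite mule_ge0// lee_fin expR_ge0.
have F0 x : (0 <= F x)%E.
  by apply: integral_ge0 => z _; rewrite mule_ge0// lee_fin expR_ge0.
transitivity (\int[normal_prob (0:R) 1]_x F (h ord0 + x)%R)%E.
  apply: eq_integral => x _; rewrite /F -(IH h' (fun z => f [tuple of (h ord0 + x)%R :: z])) //; last first.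
    exact: (measurableT_comp mf).
  apply: eq_integral => z _; congr f; apply: eq_from_tnth => i.
  rewrite tnth_mktuple; case: (unliftP ord0 i) => [j|] ->.
    by rewrite !tnthS tnth_mktuple.
  by rewrite !tnth0.
etransitivity; first exact: (normal_prob_shift _ mF F0).
apply: eq_integral => x _.
have fT0 z : [set: n.-tuple R] z -> (0 <= f [tuple of x :: z] * (T z)%:E)%E.
  by move=> _; rewrite mule_ge0// lee_fin expR_ge0.
have E0 : (0 <= (expR (h ord0 * x - 2^-1 * h ord0 ^+ 2))%:E)%E by rewrite lee_fin expR_ge0.
rewrite -(ge0_integralZr _ measurableT (mfx x) fT0 E0).
apply: eq_integral => z _; rewrite -muleA -EFinM; congr (_ * _%:E)%E.
rewrite /T -expRD; congr expR; rewrite !big_ord_recl tnth0.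
under [in RHS]eq_bigr do rewrite tnthS.
by rewrite mulrDr; ring.
Qed.

(** * Densities and Laplace transforms of multivariate normal laws *)

Lemma posdef_unitmx (R : realType) (n : nat) (S : 'M[R]_n) :
  posdef S -> S \in unitmx.
Proof.
move=> [_ Spos]; rewrite -row_free_unit -kermx_eq0; apply/rowV0P => v /sub_kermxP vS.
apply/eqP; apply: contraT => v0; have := Spos v^T.
by rewrite trmx_eq0 v0 trmxK vS mul0mx mxE ltxx => /(_ isT).
Qed.

Lemma measurable_lin_form (R : realType) (n : nat) (a : 'rV[R]_n) :
  measurable_fun setT (fun y : n.-tuple R => (a *m colt y) 0 0).
Proof.
rewrite (_ : (fun _ => _) = fun y : n.-tuple R => \sum_i a 0 i * tnth y i); last first.
  by apply/funext => y; rewrite mxE; apply: eq_bigr => i _; rewrite mxE.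
apply: measurable_sum => i.
by apply: measurable_funM => //; exact: measurable_tnth.
Qed.

(** If [B *m B^T = S] then [mu + B *m z = B *m (z + B^-1 *m mu)], so a change of
    mean is a translation of the underlying standard normal vector by
    [h = B^-1 *m mu]; and [h^T *m z], [h^T *m h] no longer depend on [B] when
    written in terms of [B *m z] and [mu]. *)
Lemma mvnormal_density (R : realType) (n : nat) (mu : 'cV[R]_n) (S : 'M[R]_n)
  (f : n.-tuple R -> \bar R) :
  posdef S -> measurable_fun setT f -> (forall y, 0 <= f y)%E ->
  (\int[mvnormal mu S]_y f y =
   \int[mvnormal 0 S]_y (f y * (expR ((mu^T *m invmx S *m colt y) 0 0
      - 2^-1 * (mu^T *m invmx S *m mu) 0 0))%:E))%E.
Proof.
move=> pS mf f0.
have mE : measurable_fun setT (fun y : n.-tuple R =>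
    (expR ((mu^T *m invmx S *m colt y) 0 0 - 2^-1 * (mu^T *m invmx S *m mu) 0 0))%:E).
  apply/measurable_EFinP/measurableT_comp => //.
  by apply: measurable_funB => //; exact: measurable_lin_form.
rewrite !ge0_integral_distribution//; last 2 first.
- exact: emeasurable_funM.
- by move=> y; rewrite mule_ge0// lee_fin expR_ge0.
set B := sqrt_factor S.
have BBT : B *m B^T = S by exact: sqrt_factorP.
have Su := posdef_unitmx pS.
have Bu : B \in unitmx by move: Su; rewrite -BBT unitmx_mul => /andP[].
have SB : invmx S *m B = (invmx B)^T.
  rewrite -[RHS](mulKmx Su); congr (_ *m _).
  by rewrite -BBT -mulmxA -trmx_mul mulVmx// trmx1 mulmx1.
(* Any square root [B] of [S] in the sense of [BBT] will do from here on. *)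
clearbody B; pose h i := (invmx B *m mu) i 0.
have coltE z : colt (affine 0 B z) = B *m colt z.
  by apply/colP => i; rewrite mxE tnth_mktuple add0r.
have affE z : affine mu B z = affine 0 B (shift_tuple h z).
  apply: eq_from_tnth => i; rewrite !tnth_mktuple add0r.
  have -> : colt (shift_tuple h z) = invmx B *m mu + colt z.
    by apply/colP => j; rewrite [RHS]mxE [LHS]mxE tnth_mktuple; congr (_ + _); rewrite mxE.
  by rewrite mulmxDr mulKVmx.
have linE z : (mu^T *m invmx S *m (B *m colt z)) 0 0 = \sum_i h i * tnth z i.
  rewrite mulmxA -(mulmxA _ _ B) SB -trmx_mul mxE.
  by apply: eq_bigr => i _; congr (_ * _); rewrite mxE.
have sqE : (mu^T *m invmx S *m mu) 0 0 = \sum_i h i ^+ 2.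
  have {2}-> : mu = B *m (invmx B *m mu) by rewrite mulKVmx.
  rewrite mulmxA -(mulmxA _ _ B) SB -trmx_mul mxE.
  by apply: eq_bigr => i _; rewrite expr2; congr (_ * _); rewrite mxE.
have mfB := measurableT_comp mf (measurable_affine 0 B).
have f0B z : (0 <= (f \o affine 0 B) z)%E by exact: f0.
transitivity (\int[std_normal n]_z f (affine 0 B (shift_tuple h z)))%E.
  by apply: eq_integral => z _; rewrite /= affE.
etransitivity; first exact: (std_normal_shift h mfB f0B).
by apply: eq_integral => z _; rewrite /= coltE linE sqE.
Qed.

(** The density of the law with mean [S *m a] has total mass 1. *)
Lemma mvnormal_mgf (R : realType) (n : nat) (S : 'M[R]_n) (a : 'cV[R]_n) (c : R) :
  posdef S ->
  (\int[mvnormal 0 S]_y (expR ((a^T *m colt y) 0 0 + c))%:E =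
   (expR (2^-1 * (a^T *m S *m a) 0 0 + c))%:E)%E.
Proof.
move=> pS; have Su := posdef_unitmx pS; have [ST _] := pS.
have := mvnormal_density (S *m a) pS (measurable_cst (1 : \bar R)%E) (fun=> lee01).
rewrite integral_cst// [X in (1 * X)%E](_ : _ = 1%E); last exact: probability_setT.
rewrite mule1 => /esym.
have -> : ((S *m a)^T *m invmx S *m (S *m a)) = a^T *m S *m a.
  by rewrite trmx_mul ST mulmxK// mulmxA.
set q := (a^T *m S *m a) 0 0 => H.
transitivity (\int[mvnormal 0 S]_y ((expR (2^-1 * q + c))%:E *
   (1 * (expR ((a^T *m colt y) 0 0 - 2^-1 * q))%:E)))%E.
  apply: eq_integral => y _; rewrite mul1e -EFinM -expRD; congr (expR _)%:E.
  by ring.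
rewrite ge0_integralZl//; last first.
  apply: measurable_funeM; apply/measurable_EFinP/measurableT_comp => //.
  by apply: measurable_funB => //; exact: measurable_lin_form.
rewrite -[RHS]mule1; congr (_ * _)%E; rewrite -[RHS]H.
by apply: eq_integral => y _; rewrite trmx_mul ST mulmxK.
Qed.

(** * Likelihood ratios *)

Lemma lik_ratioE (R : realType) (n : nat) (S : 'M[R]_n) (I : set R) (delta : R)
  (y : n.-tuple R) :
  let mu := delta *: ind n I in
  lik_ratio S I delta y = expR ((mu^T *m invmx S *m colt y) 0 0
    - 2^-1 * (mu^T *m invmx S *m mu) 0 0).
Proof.
move=> mu; have muT : mu^T = delta *: (ind n I)^T by exact: linearZ.
rewrite /lik_ratio /sigtilde muT -!scalemxAl /mu -scalemxAr.
by rewrite !mxE; congr expR; ring.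
Qed.

Lemma measurable_lik_ratio (R : realType) (n : nat) (S : 'M[R]_n) (I : set R) (delta : R) :
  measurable_fun setT (@lik_ratio R n S I delta).
Proof.
apply: measurableT_comp => //; apply: measurable_funB => //.
by apply: measurable_funM => //; exact: measurable_lin_form.
Qed.

(** Change of measure from the null hypothesis to the alternative. *)
Lemma P1_lik_ratio (R : realType) (n : nat) (S : 'M[R]_n) (I : set R) (delta : R)
  (A : set (n.-tuple R)) :
  posdef S -> measurable A ->
  (P1 S I delta A = \int[P0 S]_y (\1_A y * lik_ratio S I delta y)%:E)%E.
Proof.
move=> pS mA.
have mI : measurable_fun setT (fun y => (\1_A y)%:E : \bar R).
  exact/measurable_EFinP/measurable_indic.
have I0 y : (0 <= (\1_A y)%:E :> \bar R)%E by rewrite lee_fin.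
transitivity (\int[P1 S I delta]_y (\1_A y)%:E)%E.
  by rewrite integral_indic// setIT.
etransitivity; first exact: (mvnormal_density _ pS mI I0).
by apply: eq_integral => y _; rewrite lik_ratioE EFinM.
Qed.

(** Under the null hypothesis the likelihood ratio is log-normal, so all its
    moments are explicit.  Exponent 1 normalizes it, exponent 2 gives square
    integrability, and an exponent slightly above 1 controls the tail. *)
Lemma integral_lik_ratio_powR (R : realType) (n : nat) (S : 'M[R]_n) (I : set R)
  (delta p : R) :
  posdef S ->
  (\int[P0 S]_y (lik_ratio S I delta y `^ p)%:E =
   (expR (2^-1 * (p * (p - 1)) * (delta ^+ 2 * sigtilde S I)))%:E)%E.
Proof.
move=> pS; have Su := posdef_unitmx pS; have [ST _] := pS.
pose a := (p * delta) *: (invmx S *m ind n I).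
pose c := - (2^-1 * p * (delta ^+ 2 * sigtilde S I)).
have aE : a^T = (p * delta) *: ((ind n I)^T *m invmx S).
  have -> : a^T = (p * delta) *: (invmx S *m ind n I)^T.
    exact: linearZ.
  by rewrite trmx_mul trmx_inv ST.
transitivity (\int[P0 S]_y (expR ((a^T *m colt y) 0 0 + c))%:E)%E.
  apply: eq_integral => y _; rewrite /lik_ratio -expRM; congr (expR _)%:E.
  by rewrite aE -scalemxAl [in RHS]mxE /c; ring.
rewrite [LHS]mvnormal_mgf//.
have -> : (a^T *m S *m a) 0 0 = (p * delta) ^+ 2 * sigtilde S I.
  rewrite aE /a -!scalemxAl -scalemxAr scalerA -(mulmxA _ (invmx S) S) mulVmx//.
  by rewrite mulmx1 mulmxA mxE expr2.
by congr (expR _)%:E; rewrite /c; ring.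
Qed.

(** * Averages of truncated nonnegative variables *)

(** For [D] the average of the [x k] truncated at [tau] this is
    [t * i * (1 - D) <= t ^+ 2 + (1 - D) ^+ 2], where [D] is bounded below by
    the average of the [x k - w k], and above by that of the [x k], while
    [D ^+ 2] is expanded and its diagonal terms are bounded by [tau * x k].
    Integrated with [i] the indicator of an event, it compares the mass of that
    event with its mass under the mixture, up to [t] and a variance over [t]. *)
Lemma mixture_pointwise (R : realType) (K : nat) (x w : 'I_K -> R) (tau t i : R) :
  (forall k, 0 <= x k) -> (forall k, 0 <= w k) ->
  (forall k, x k <= tau \/ x k <= w k) -> 0 <= tau -> 0 <= t -> 0 <= i <= 1 ->
  t * i + 2 * K%:R^-1 * \sum_k x k
  <= t * K%:R^-1 * (\sum_k i * x k) + (t ^+ 2 + 1)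
     + K%:R^-1 ^+ 2 * (tau * (\sum_k x k) + \sum_k \sum_(l < K | l != k) x k * x l)
     + 2 * K%:R^-1 * \sum_k w k.
Proof.
move=> x0 w0 xtw tau0 t0 /andP[i0 i1].
pose x' k := if x k <= tau then x k else 0.
have x'0 k : 0 <= x' k by rewrite /x'; case: ifP.
have x'x k : x' k <= x k by rewrite /x'; case: ifP.
have xx'w k : x k <= x' k + w k.
  rewrite /x'; case: ifPn => [_|]; first by rewrite lerDl.
  by case: (xtw k) => [->//|xw _]; rewrite add0r.
set c := K%:R^-1; have c0 : 0 <= c by rewrite invr_ge0.
pose D := c * \sum_k x' k.
have e1 : c * \sum_k x k <= D + c * \sum_k w k.
  rewrite /D -mulrDr -big_split/= ler_wpM2l// ler_sum// => k _; exact: xx'w.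
have e2 : i * D <= c * \sum_k i * x k.
  rewrite -mulr_sumr mulrCA /D ler_wpM2l// ler_wpM2l// ler_sum// => k _; exact: x'x.
have e3 : D ^+ 2 <= c ^+ 2 * (tau * (\sum_k x k) + \sum_k \sum_(l < K | l != k) x k * x l).
  rewrite /D exprMn ler_wpM2l ?sqr_ge0//.
  rewrite expr2 mulr_suml mulr_sumr -big_split/= ler_sum// => k _.
  rewrite mulr_sumr (bigD1 k)//=; apply: lerD; last first.
    by apply: ler_sum => l _; exact: ler_pM.
  rewrite /x'; case: ifPn => [xt|xt]; first by rewrite ler_wpM2r.
  by rewrite mul0r mulr_ge0.
(* The quadratic form in [1 - D] and [t] is nonnegative because [i <= 2]. *)
have e4 : t * i + 2 * D <= t * (i * D) + t ^+ 2 + 1 + D ^+ 2.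
  have h : 0 <= 1 - i ^+ 2 / 4 by nra.
  have -> : t * (i * D) + t ^+ 2 + 1 + D ^+ 2 = t * i + 2 * D +
    ((1 - D - t * i / 2) ^+ 2 + t ^+ 2 * (1 - i ^+ 2 / 4)) by field.
  by rewrite lerDl addr_ge0 ?sqr_ge0// mulr_ge0// sqr_ge0.
have e5 : t * (i * D) <= t * (c * \sum_k i * x k).
  exact: ler_wpM2l.
rewrite -!mulrA; lra.
Qed.

Section nonneg_measurable.
Context d (T : measurableType d) (R : realType) (P : {measure set T -> \bar R}).
Implicit Types f g : T -> R.

(** The functions for which integration is additive in the extended reals with
    no integrability condition. *)
Definition nnmeas f := measurable_fun setT f /\ forall y, 0 <= f y.

Lemma nnmeasD f g : nnmeas f -> nnmeas g -> nnmeas (fun y => f y + g y).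
Proof.
move=> [mf f0] [mg g0]; split; first exact: measurable_funD.
by move=> y; rewrite addr_ge0.
Qed.

Lemma nnmeasM f g : nnmeas f -> nnmeas g -> nnmeas (fun y => f y * g y).
Proof.
move=> [mf f0] [mg g0]; split; first exact: measurable_funM.
by move=> y; rewrite mulr_ge0.
Qed.

Lemma nnmeas_cst c : 0 <= c -> nnmeas (fun=> c).
Proof. by move=> c0; split => //; exact: measurable_cst. Qed.

Lemma nnmeasZ c f : 0 <= c -> nnmeas f -> nnmeas (fun y => c * f y).
Proof. by move=> c0 nf; apply: nnmeasM => //; exact: nnmeas_cst. Qed.

Lemma nnmeas_sum (J : finType) (p : pred J) (f : J -> T -> R) :
  (forall j, nnmeas (f j)) -> nnmeas (fun y => \sum_(j | p j) f j y).
Proof.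
move=> nf; split; last by move=> y; apply: sumr_ge0 => j _; case: (nf j).
rewrite (_ : (fun _ => _) = fun y => \sum_(j <- [seq j <- index_enum J | p j]) f j y).
  by apply: measurable_sum => j; case: (nf j).
by apply/funext => y; rewrite big_filter.
Qed.

Lemma nnmeas_integralD f g : nnmeas f -> nnmeas g ->
  (\int[P]_y (f y + g y)%:E = \int[P]_y (f y)%:E + \int[P]_y (g y)%:E)%E.
Proof.
move=> [mf f0] [mg g0]; under eq_integral do rewrite EFinD.
rewrite ge0_integralD//; do ?exact/measurable_EFinP.
- by move=> y _; rewrite lee_fin.
- by move=> y _; rewrite lee_fin.
Qed.

Lemma nnmeas_integralZ c f : 0 <= c -> nnmeas f ->
  (\int[P]_y (c * f y)%:E = c%:E * \int[P]_y (f y)%:E)%E.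
Proof.
move=> c0 [mf f0]; under eq_integral do rewrite EFinM.
rewrite ge0_integralZl//; first exact/measurable_EFinP.
by move=> y _; rewrite lee_fin.
Qed.

Lemma nnmeas_integral_sum (J : finType) (p : pred J) (f : J -> T -> R) :
  (forall j, nnmeas (f j)) ->
  (\int[P]_y (\sum_(j | p j) f j y)%:E = \sum_(j | p j) \int[P]_y (f j y)%:E)%E.
Proof.
move=> nf; under eq_integral do rewrite -sumEFin -big_filter.
rewrite ge0_integral_sum//.
- by rewrite big_filter.
- by move=> j; apply/measurable_EFinP; case: (nf j).
- by move=> j y _; rewrite lee_fin; case: (nf j).
Qed.

Lemma nnmeas_le_integral f g : nnmeas f -> nnmeas g -> (forall y, f y <= g y) ->
  (\int[P]_y (f y)%:E <= \int[P]_y (g y)%:E)%E.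
Proof.
move=> [mf f0] [mg g0] fg; apply: ge0_le_integral => //.
- by move=> y _; rewrite lee_fin.
- exact/measurable_EFinP.
- exact/measurable_EFinP.
- by move=> y _; rewrite lee_fin.
Qed.

End nonneg_measurable.

(** The left side is [t * P A + 2 * E Xbar] with [E Xbar = 1], for [Xbar] the
    average of the [X k]; the constants 2 and 1 are left uncancelled since the
    inequality is between extended reals. *)
Lemma mixture_integral d (T : measurableType d) (R : realType)
  (P : probability T R) (K : nat) (X W : 'I_K -> T -> R) (A : set T)
  (tau t eta : R) :
  (0 < K)%N -> measurable A ->
  (forall k, nnmeas (X k)) -> (forall k, nnmeas (W k)) ->
  (forall k y, X k y <= tau \/ X k y <= W k y) -> 0 <= tau -> 0 <= t ->
  (forall k, \int[P]_y (X k y)%:E = 1)%E ->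
  (forall k, \int[P]_y (W k y)%:E <= eta%:E)%E ->
  (t%:E * P A + 2%:E
   <= (t * K%:R^-1)%:E * (\sum_k \int[P]_y (\1_A y * X k y)%:E) + (t ^+ 2 + 1)%:E
     + (K%:R^-1 ^+ 2)%:E * ((tau * K%:R)%:E
         + \sum_k \sum_(l < K | l != k) \int[P]_y (X k y * X l y)%:E)
     + (2 * eta)%:E)%E.
Proof.
move=> K0 mA nX nW XtW tau0 t0 X1 Weta.
have n1 : nnmeas (\1_A : T -> R) by split.
have K00 : 0 <= K%:R^-1 :> R by rewrite invr_ge0.
have t2K : 0 <= 2 * K%:R^-1 :> R by rewrite mulr_ge0.
have tK : 0 <= t * K%:R^-1 by rewrite mulr_ge0.
have K2 : 0 <= K%:R^-1 ^+ 2 :> R by rewrite sqr_ge0.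
have t21 : 0 <= t ^+ 2 + 1 by rewrite addr_ge0 ?sqr_ge0.
have nXX k l : nnmeas (fun y => X k y * X l y) by exact: nnmeasM.
have n1X k : nnmeas (fun y => \1_A y * X k y) by exact: nnmeasM.
have nL1 : nnmeas (fun y => t * \1_A y) by exact: nnmeasZ.
have nsX : nnmeas (fun y => \sum_k X k y) by exact: nnmeas_sum.
have nL2 : nnmeas (fun y => 2 * K%:R^-1 * \sum_k X k y) by exact: nnmeasZ.
have ns1 : nnmeas (fun y => \sum_k \1_A y * X k y) by exact: nnmeas_sum.
have nR1 : nnmeas (fun y => t * K%:R^-1 * \sum_k \1_A y * X k y) by exact: nnmeasZ.
have nR2 : @nnmeas _ T R (fun=> t ^+ 2 + 1) by exact: nnmeas_cst.
have nR12 := nnmeasD nR1 nR2.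
have nR3 : nnmeas (fun y => tau * \sum_k X k y) by exact: nnmeasZ.
have nR4' k : nnmeas (fun y => \sum_(l < K | l != k) X k y * X l y).
  exact: nnmeas_sum.
have nR4 : nnmeas (fun y => \sum_k \sum_(l < K | l != k) X k y * X l y).
  exact: nnmeas_sum.
have nR34 := nnmeasD nR3 nR4.
have nR5 := nnmeasZ K2 nR34.
have nsW : nnmeas (fun y => \sum_k W k y) by exact: nnmeas_sum.
have nR6 := nnmeasZ t2K nsW.
have nR125 := nnmeasD nR12 nR5.
have i01 y : 0 <= (\1_A y : R) <= 1 by rewrite indicE; case: (y \in A); rewrite ?lexx ?ler01.
have := nnmeas_le_integral P (nnmeasD nL1 nL2) (nnmeasD nR125 nR6)
  (fun y => mixture_pointwise (fun k => (nX k).2 y) (fun k => (nW k).2 y)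
    (XtW^~ y) tau0 t0 (i01 y)); cbv beta.
have sX : (\int[P]_y (\sum_k X k y)%:E = K%:R%:E)%E.
  by rewrite nnmeas_integral_sum// (eq_bigr _ (fun k _ => X1 k)) sumEFin sumr_const card_ord.
have KK : K%:R^-1 * K%:R = 1 :> R by rewrite mulVf// pnatr_eq0 -lt0n.
rewrite (nnmeas_integralD P nL1 nL2) (nnmeas_integralD P nR125 nR6).
rewrite (nnmeas_integralD P nR12 nR5) (nnmeas_integralD P nR1 nR2).
rewrite (nnmeas_integralZ P t0 n1) (nnmeas_integralZ P t2K nsX) sX.
rewrite (nnmeas_integralZ P tK ns1) (nnmeas_integralZ P K2 nR34).
rewrite (nnmeas_integralD P nR3 nR4) (nnmeas_integralZ P tau0 nsX) sX.
rewrite (nnmeas_integralZ P t2K nsW) integral_indic// setIT integral_cst//.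
rewrite [X in ((_ ^+ 2 + 1)%:E * X)%E](_ : _ = 1%E); last exact: probability_setT.
rewrite mule1.
rewrite !nnmeas_integral_sum//.
rewrite -!EFinM -[2 * K%:R^-1 * _]mulrA KK mulr1.
rewrite (eq_bigr _ (fun k _ => nnmeas_integral_sum P (fun l => l != k) (nXX k))).
move=> /le_trans; apply; apply: leeD => //.
rewrite EFinM -muleA [leRHS]EFinM lee_pmul2l// ?lte_fin//.
apply: (@le_trans _ _ (K%:R^-1%:E * \sum_(k < K) eta%:E)%E).
  by rewrite lee_pmul2l ?lte_fin ?invr_gt0 ?ltr0n//; apply: lee_sum.
by rewrite sumEFin sumr_const card_ord -EFinM -[eta *+ K]mulr_natl mulrA KK mul1r.
Qed.

(** * Covariances of likelihood ratios *)

Lemma nnmeas_Lfun1 d (T : measurableType d) (R : realType)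
  (P : probability T R) (f : T -> R) :
  nnmeas f -> (\int[P]_y (f y)%:E < +oo)%E -> f \in Lfun P 1.
Proof.
move=> [mf f0] foo; apply/Lfun1_integrable/integrableP; split.
  exact/measurable_EFinP.
by under eq_integral do rewrite /= ger0_norm//.
Qed.

Section likelihood_ratios.
Context (R : realType) (n : nat) (S : 'M[R]_n).
Hypothesis pS : posdef S.
Implicit Types (I J : set R) (delta : R).

Lemma nnmeas_lik_ratio I delta : nnmeas (@lik_ratio R n S I delta).
Proof.
by split; [exact: measurable_lik_ratio|move=> y; exact: expR_ge0].
Qed.

Lemma integral_lik_ratio I delta :
  (\int[P0 S]_y (lik_ratio S I delta y)%:E = 1)%E.
Proof.
have := integral_lik_ratio_powR I delta 1 pS.
rewrite subrr mulr0 mulr0 mul0r expR0 => <-.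
by apply: eq_integral => y _; rewrite powRr1// expR_ge0.
Qed.

Lemma integral_lik_ratioM I J delta :
  (\int[P0 S]_y (lik_ratio S I delta y * lik_ratio S J delta y)%:E < +oo)%E.
Proof.
have nsq K : nnmeas (fun y => @lik_ratio R n S K delta y `^ 2).
  split; last by move=> y; exact: powR_ge0.
  exact: (measurableT_comp (measurable_powR 2) (measurable_lik_ratio S K delta)).
apply: (@le_lt_trans _ _ (\int[P0 S]_y
   (lik_ratio S I delta y `^ 2 + lik_ratio S J delta y `^ 2)%:E)%E).
  apply: nnmeas_le_integral.
  - by apply: nnmeasM; exact: nnmeas_lik_ratio.
  - exact: nnmeasD.
  - move=> y; rewrite !powR_mulrn ?expR_ge0//; nra.
rewrite (nnmeas_integralD (P0 S) (nsq I) (nsq J)).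
have fin K : (\int[P0 S]_y (lik_ratio S K delta y `^ 2)%:E < +oo)%E.
  by rewrite (integral_lik_ratio_powR K delta 2 pS) ltry.
exact: (lte_add_pinfty (fin I) (fin J)).
Qed.

Lemma covariance_lik_ratio I J delta :
  covariance (P0 S) (lik_ratio S I delta) (lik_ratio S J delta) =
  (\int[P0 S]_y (lik_ratio S I delta y * lik_ratio S J delta y)%:E - 1)%E.
Proof.
have L1 K : @lik_ratio R n S K delta \in Lfun (P0 S) 1.
  by apply: nnmeas_Lfun1; [exact: nnmeas_lik_ratio|rewrite integral_lik_ratio ltry].
rewrite covarianceE//; last first.
  apply: nnmeas_Lfun1; last exact: integral_lik_ratioM.
  by apply: nnmeasM; exact: nnmeas_lik_ratio.
by rewrite unlock !integral_lik_ratio mule1.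
Qed.

End likelihood_ratios.

Lemma inf_itv0 (R : realType) (lam : R) (k : nat) : 0 < lam ->
  inf (itv0 lam k) = k%:R * lam.
Proof.
by move=> l0; rewrite /itv0 inf_itv//= bnd_simp ltr_pM2r// ltr_nat.
Qed.

Lemma itv0_interval (R : realType) (lam : R) (k : nat) : 0 < lam ->
  (k < Num.truncn lam^-1)%N -> intervals lam (itv0 lam k).
Proof.
move=> l0; rewrite truncn_gt_nat => kl.
exists (k%:R * lam), (k.+1%:R * lam); split => //.
- by rewrite mulr_ge0// ltW.
- by rewrite ltr_pM2r// ltr_nat.
- by rewrite -ler_pdivlMr// mul1r.
- by rewrite -mulrBl -natrB// subSnn mul1r.
Qed.

(** Distinct intervals of the grid have infima at distance at least [lam], so
    once [m < n * lam] the separation condition only removes the diagonal. *)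
Lemma avg_covE (R : realType) (n : nat) (S : 'M[R]_n) (lam Delta : R) (m : nat) :
  let K := Num.truncn lam^-1 in
  let L k := @lik_ratio R n S (itv0 lam k) Delta in
  posdef S -> 0 < lam -> m%:R < n%:R * lam ->
  avg_cov S lam Delta m = ((K%:R ^- 2)%:E *
   \sum_(k < K) \sum_(l < K | l != k) (\int[P0 S]_y (L k y * L l y)%:E - 1))%E.
Proof.
move=> K L pS l0 mn; rewrite /avg_cov; congr (_ * _)%E.
apply: eq_bigr => k _; apply: eq_big => [l|l _]; last exact: covariance_lik_ratio.
rewrite !inf_itv0// -mulrBl normrM (gtr0_norm l0) mulrCA.
have [->|lk] := eqVneq l k; first by rewrite subrr normr0 mul0r ltNge ler0n.
apply: (lt_le_trans mn); rewrite ler_peMl//; first by rewrite mulr_ge0// ltW.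
wlog kl : k l lk / (k < l)%N => [H|].
  move: lk; rewrite -val_eqE/= neq_ltn => /orP[] kl; last by apply: H => //; rewrite -val_eqE/= gtn_eqF.
  by rewrite distrC; apply: H => //; rewrite -val_eqE/= gtn_eqF.
rewrite distrC -(natrB _ (ltnW kl)) ger0_norm ?ler0n//.
by rewrite ler1n subn_gt0.
Qed.

(** * The error bound for a fixed sample size *)

Lemma measurable_decision d (T : measurableType d) (Phi : T -> bool) (b : bool) :
  measurable_fun setT Phi -> measurable [set y | Phi y = b].
Proof. by move=> mPhi; rewrite -[X in measurable X]setTI; exact: (mPhi _ [set b]). Qed.

Lemma P1_le_err2 (R : realType) (n : nat) (S : 'M[R]_n) (lam Delta : R)
  (Phi : n.-tuple R -> bool) (I : set R) :
  intervals lam I -> 0 <= Delta ->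
  (P1 S I Delta [set y | Phi y = false] <= err2 S lam Delta Phi)%E.
Proof.
move=> II D0; apply: le_ereal_sup_tmp.
eexists; first by exists I.
apply: ereal_sup_ubound; exists Delta => //=; exact: ler_norm.
Qed.

Lemma err2_fin_num (R : realType) (n : nat) (S : 'M[R]_n) (lam Delta : R)
  (Phi : n.-tuple R -> bool) :
  0 < lam < 1 -> 0 <= Delta -> measurable_fun setT Phi ->
  err2 S lam Delta Phi \is a fin_num.
Proof.
move=> /andP[l0 l1] D0 mPhi.
have mA : measurable [set y | Phi y = false] by exact: measurable_decision.
rewrite fin_real//; apply/andP; split.
  have /(P1_le_err2 S Phi) : intervals lam (itv0 lam 0).
    by apply: itv0_interval => //; rewrite truncn_gt0 invf_ge1// ltW.
  by move=> /(_ _ D0) h; apply: (@lt_le_trans _ _ 0%E) => //; apply: le_trans h.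
apply: (@le_lt_trans _ _ 1%E); last exact: ltry.
apply: ge_ereal_sup => _ [I _ <-]; apply: ge_ereal_sup => _ [d _ <-].
exact: probability_le1.
Qed.

Section finite_sample.
Context (R : realType).

(** The Chernoff-type majorant of the part of [expR x] above the level [expR a]. *)
Lemma truncated_or_dominated (a e x : R) : 0 <= e ->
  expR x <= expR a \/ expR x <= expR (- (e * a)) * expR x `^ (1 + e).
Proof.
move=> e0; case: (lerP x a) => xa; first by left; rewrite ler_expR.
by right; rewrite -expRM -expRD ler_expR; nra.
Qed.

(** With [s = Delta ^+ 2 * sigtilde S I] the left side is the logarithm of
    [tau `^ (- e) * E (L `^ (1 + e))] at [tau = expR (l * (1 - e / 2))].  At the
    largest [s] allowed, the two sides differ by [e ^+ 3 * (1 - e) * l]. *)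
Lemma tail_exponent (e l s : R) : 0 <= e <= 1 -> 0 <= l -> s <= 2 * (1 - e) ^+ 2 * l ->
  - (e * (l * (1 - e / 2))) + 2^-1 * ((1 + e) * (1 + e - 1)) * s
  <= - (e ^+ 2 * l / 2).
Proof.
move=> /andP[e0 e1] l0 hs.
have h1 : 2^-1 * ((1 + e) * (1 + e - 1)) * s <=
    2^-1 * ((1 + e) * (1 + e - 1)) * (2 * (1 - e) ^+ 2 * l).
  by apply: ler_wpM2l => //; nra.
apply: (le_trans (lerD (lexx _) h1)); rewrite -subr_ge0.
have -> : - (e ^+ 2 * l / 2) - (- (e * (l * (1 - e / 2))) +
   2^-1 * ((1 + e) * (1 + e - 1)) * (2 * (1 - e) ^+ 2 * l)) =
   e ^+ 3 * (1 - e) * l by field.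
by rewrite !mulr_ge0 ?exprn_ge0 ?subr_ge0.
Qed.

Lemma truncn_inv_ge (lam : R) : 0 < lam -> lam <= 2^-1 ->
  (2 * lam)^-1 <= (Num.truncn lam^-1)%:R.
Proof.
move=> l0 l2; have := truncnS_gt lam^-1; rewrite -natr1 => h.
have h2 : 2 <= lam^-1 by rewrite -[leLHS]invrK lef_pV2 ?posrE ?invr_gt0.
rewrite invfM; lra.
Qed.

(** The two exponentially small errors, [tau / K] from the truncated diagonal
    and twice the mass lost by truncation, are each at most
    [2 * expR (- (e ^+ 2 * l / 2))], which gives the factor 4.  Here
    [e * l >= e ^+ 2 * l] replaces the exponent of the first one by that of the
    second, so that a single quantity has to vanish in the limit. *)
Lemma finite_sample_bound (n : nat) (S : 'M[R]_n) (lam Delta e t : R) (m : nat)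
  (Phi : n.-tuple R -> bool) :
  let l := - ln lam in
  posdef S -> 0 < lam -> lam <= 2^-1 -> 0 <= Delta -> 0 <= e <= 1 -> 0 <= t ->
  (forall k, (k < Num.truncn lam^-1)%N ->
     Delta ^+ 2 * sigtilde S (itv0 lam k) <= 2 * (1 - e) ^+ 2 * l) ->
  m%:R < n%:R * lam -> measurable_fun setT Phi ->
  t * fine (P0 S [set y | Phi y = false])
  <= t * fine (err2 S lam Delta Phi) + t ^+ 2 + fine (avg_cov S lam Delta m)
     + 4 * expR (- (e ^+ 2 * l / 2)).
Proof.
move=> l pS l0 l2 D0 e01 t0 hs mn mPhi; have /andP[e0 e1] := e01.
have l01 : 0 < lam < 1 by rewrite l0/=; lra.
have ll0 : 0 <= l by rewrite /l oppr_ge0 ln_le0//; lra.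
set K := Num.truncn lam^-1 in hs *.
have Kge : (2 * lam)^-1 <= K%:R :> R by exact: truncn_inv_ge.
have Kp : 0 < K%:R :> R by apply: lt_le_trans Kge; rewrite invr_gt0 mulr_gt0.
have K0 : (0 < K)%N by rewrite -(ltr0n R).
have mA : measurable [set y | Phi y = false] by exact: measurable_decision.
set A := [set y | Phi y = false] in mA *.
pose a := l * (1 - e / 2); pose eta := expR (- (e ^+ 2 * l / 2)).
pose X (k : 'I_K) := @lik_ratio R n S (itv0 lam k) Delta.
pose W (k : 'I_K) y := expR (- (e * a)) * X k y `^ (1 + e).
have nX k : nnmeas (X k) by exact: nnmeas_lik_ratio.
have npow k : nnmeas (fun y => X k y `^ (1 + e)).
  split; last by move=> y; exact: powR_ge0.
  exact: (measurableT_comp (measurable_powR (1 + e)) (nX k).1).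
have nW k : nnmeas (W k) by apply: nnmeasZ => //; exact: expR_ge0.
have XW k y : X k y <= expR a \/ X k y <= W k y.
  exact: truncated_or_dominated.
have iX k : (\int[P0 S]_y (X k y)%:E = 1)%E by exact: integral_lik_ratio.
have iW k : (\int[P0 S]_y (W k y)%:E <= eta%:E)%E.
  rewrite (nnmeas_integralZ (P0 S) (expR_ge0 _) (npow k)).
  rewrite (integral_lik_ratio_powR (itv0 lam k) Delta (1 + e) pS).
  by rewrite -EFinM lee_fin -expRD ler_expR; apply: tail_exponent => //; exact: hs.
have := mixture_integral K0 mA nX nW XW (expR_ge0 a) t0 iX iW.
pose g k j := fine (\int[P0 S]_y (X k y * X j y)%:E).
have gE k j : (\int[P0 S]_y (X k y * X j y)%:E = (g k j)%:E)%E.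
  rewrite fineK// ge0_fin_numE; first exact: integral_lik_ratioM.
  by apply: integral_ge0 => y _; rewrite lee_fin mulr_ge0 ?(nX _).2.
pose b := fine (err2 S lam Delta Phi).
have bE : err2 S lam Delta Phi = b%:E by rewrite fineK// err2_fin_num.
pose p := fine (P0 S A).
have pE : P0 S A = p%:E by rewrite fineK// fin_num_measure.
have i1X k : (\int[P0 S]_y (\1_A y * X k y)%:E <= b%:E)%E.
  rewrite -bE -(P1_lik_ratio _ _ pS mA); apply: P1_le_err2 => //.
  exact: itv0_interval.
have cE : avg_cov S lam Delta m =
    (K%:R ^- 2 * \sum_(k < K) \sum_(j < K | j != k) (g k j - 1))%:E.
  rewrite (avg_covE Delta pS l0 mn) EFinM -sumEFin; congr (_ * _)%E.
  apply: eq_bigr => k _; rewrite -sumEFin; apply: eq_bigr => j _.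
  by rewrite gE.
pose G := \sum_(k < K) \sum_(j < K | j != k) g k j.
have GE : (\sum_(k < K) \sum_(j < K | j != k) \int[P0 S]_y (X k y * X j y)%:E = G%:E)%E.
  rewrite /G -sumEFin; apply: eq_bigr => k _; rewrite -sumEFin.
  by apply: eq_bigr => j _; rewrite gE.
rewrite GE pE cE bE /= => mix.
have sb : (\sum_(k < K) \int[P0 S]_y (\1_A y * X k y)%:E <= (K%:R * b)%:E)%E.
  apply: (@le_trans _ _ (\sum_(k < K) b%:E)%E); first exact: lee_sum.
  by rewrite sumEFin sumr_const card_ord mulr_natl.
have {mix} : t * p + 2 <= t * b + (t ^+ 2 + 1)
    + K%:R^-1 ^+ 2 * (expR a * K%:R + G) + 2 * eta.
  rewrite -lee_fin !EFinD; apply: (le_trans mix); rewrite !EFinD.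
  apply: leeD => //; apply: leeD => //; apply: leeD => //.
  have -> : t * b = t * K%:R^-1 * (K%:R * b) by field; rewrite gt_eqF.
  by rewrite [leRHS]EFinM; apply: lee_wpmul2l => //; rewrite lee_fin mulr_ge0// invr_ge0 ltW.
have aK : K%:R^-1 ^+ 2 * (expR a * K%:R) <= 2 * eta.
  have -> : K%:R^-1 ^+ 2 * (expR a * K%:R) = expR a / K%:R by field; rewrite gt_eqF.
  rewrite ler_pdivrMr//; apply: (@le_trans _ _ (2 * eta * (2 * lam)^-1)); last first.
    by rewrite ler_wpM2l// mulr_ge0// expR_ge0.
  have -> : lam = expR (- l) by rewrite opprK lnK.
  rewrite invfM mulrACA mulfV// mul1r -expRN opprK -expRD ler_expR /a.
  have : e ^+ 2 * l <= e * l by rewrite ler_wpM2r// expr2 ler_piMl.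
  lra.
(* Covariances subtract 1 from each of the at most [K ^ 2] mixed moments. *)
have GK : K%:R ^- 2 * \sum_(k < K) \sum_(j < K | j != k) (g k j - 1) >=
    K%:R^-1 ^+ 2 * G - 1.
  rewrite exprVn; have -> : K%:R ^- 2 * G - 1 = K%:R ^- 2 * (G - K%:R ^+ 2) :> R.
    by field; rewrite gt_eqF.
  rewrite ler_wpM2l ?invr_ge0 ?exprn_ge0 ?(ltW Kp)//.
  rewrite lerBlDr -lerBlDl /G -sumrB.
  rewrite (eq_bigr (fun k => \sum_(j < K | j != k) 1)); last first.
    move=> k _; rewrite -sumrB; apply: eq_bigr => j _; lra.
  apply: (@le_trans _ _ (\sum_(k < K) \sum_(j < K) 1)).
    by apply: ler_sum => k _; rewrite [leRHS](bigD1 k)//= lerDr.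
  by rewrite !sumr_const card_ord -mulrnA -natrX.
rewrite mulrDr -/eta; lra.
Qed.

End finite_sample.

(** * Passage to the limit *)

Lemma limn_esup_lt_near (R : realType) (u : (\bar R)^nat) (a : \bar R) :
  (limn_esup u < a)%E -> \forall n \near \oo, (u n < a)%E.
Proof.
rewrite limn_esup_lim => ua.
have cu := @is_cvg_esups R u.
have [N _ HN] : \forall n \near \oo, (esups u n < a)%E.
  exact: (cu _ (open_nbhs_nbhs (conj (@open_ereal_lt_ereal _ a) ua))).
exists N => // n /= Nn; apply: le_lt_trans (HN n Nn).
by apply: ereal_sup_ubound; exists n => /=.
Qed.

Lemma limn_esup_ge_near (R : realType) (u : (\bar R)^nat) (a : \bar R) :
  (\forall n \near \oo, (a <= u n)%E) -> (a <= limn_esup u)%E.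
Proof.
move=> au; rewrite limn_esup_lim; apply: lime_ge; first exact: is_cvg_esups.
near=> n; apply: (@le_trans _ _ (u n)); first by near: n.
by apply: ereal_sup_ubound; exists n => /=.
Unshelve. all: by end_near. Qed.

(** The square of the detection bound, with [eps / sqrt 2] as relative margin.
    If [s < 0] then [sqrt s = 0], and the left side is nonpositive. *)
Lemma energy_bound (R : realType) (s Delta eps lam : R) :
  0 < lam < 1 -> 0 <= Delta -> eps <= Num.sqrt 2 ->
  Delta * Num.sqrt s <= (Num.sqrt 2 - eps) * Num.sqrt (- ln lam) ->
  Delta ^+ 2 * s <= 2 * (1 - eps / Num.sqrt 2) ^+ 2 * - ln lam.
Proof.
move=> /andP[l0 l1] D0 e2 h.
have ll : 0 <= - ln lam by rewrite oppr_ge0 ln_le0// ltW.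
have s2 : 0 < Num.sqrt 2 :> R by rewrite sqrtr_gt0.
have -> : 2 * (1 - eps / Num.sqrt 2) ^+ 2 * - ln lam =
    ((Num.sqrt 2 - eps) * Num.sqrt (- ln lam)) ^+ 2.
  rewrite exprMn sqr_sqrtr// -[X in X * _ ^+ 2](@sqr_sqrtr _ 2)// -exprMn.
  by congr (_ ^+ 2 * _); rewrite mulrBr mulr1 mulrCA mulfV ?mulr1// gt_eqF.
have [s0|s0] := leP 0 s.
  by rewrite -[X in _ * X](sqr_sqrtr s0) -exprMn ler_sqr ?nnegrE ?mulr_ge0 ?subr_ge0 ?sqrtr_ge0.
by apply: (@le_trans _ _ 0); [rewrite nmulr_lle0// sqr_ge0|exact: sqr_ge0].
Qed.

Lemma expRN_le_inv (R : realType) (x : R) : 0 < x -> expR (- x) <= x^-1.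
Proof.
move=> x0; rewrite expRN lef_pV2 ?posrE ?expR_gt0//.
by apply: le_trans (expR_ge1Dx x); rewrite lerDr.
Qed.

Unset Implicit Arguments.

Theorem lemma5p8 (R : realType) (alpha : R) (lam Delta eps : nat -> R)
  (Sigma : forall n : nat, 'M[R]_n)
  (halpha : 0 < alpha < 1)
  (hlam01 : forall n : nat, (0 < n)%N -> 0 < lam n < 1)
  (hlam0 : lam n @[n --> \oo] --> (0 : R))
  (hnlam : n%:R * lam n @[n --> \oo] --> +oo)
  (hSigma : forall n : nat, (0 < n)%N -> posdef (Sigma n))
  (hDelta : forall n : nat, (0 < n)%N -> 0 < Delta n)
  (heps0 : eps n @[n --> \oo] --> (0 : R))
  (hepslam : eps n * Num.sqrt (- ln (lam n)) @[n --> \oo] --> +oo)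
  (hbound : \forall n \near \oo,
    ((Delta n)%:E *
       ereal_sup [set (Num.sqrt (sigtilde (Sigma n) I))%:E
                 | I in intervals (lam n)]
     <= ((Num.sqrt 2 - eps n) * Num.sqrt (- ln (lam n)))%:E)%E)
  (hcov : exists m : nat,
    avg_cov (Sigma n) (lam n) (Delta n) m @[n --> \oo] --> 0%E)
  (Phi : forall n : nat, n.-tuple R -> bool)
  (hPhi : forall n : nat, measurable_fun setT (Phi n)) :
  (limn_esup (fun n => err1 (Sigma n) (Phi n)) <= alpha%:E)%E ->
  ((1 - alpha)%:E <=
     limn_esup (fun n => err2 (Sigma n) (lam n) (Delta n) (Phi n)))%E.
Proof.
move=> hlevel; have [m hm] := hcov.
have s2 : 1 <= Num.sqrt 2 :> R by rewrite -[leLHS]sqrtr1 ler_wsqrtr// ler1n.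
have s20 : 0 < Num.sqrt 2 :> R by apply: lt_le_trans s2.
have /fine_cvgP[_ hm0] := hm.
(* The error is [t] from the level and twice [t] from [finite_sample_bound]. *)
apply/lee_addgt0Pr => t' t'0; pose t := t' / 4; have t0 : 0 < t by rewrite divr_gt0.
rewrite -leeBlDr// -EFinB; apply: limn_esup_ge_near.
have t20 : 0 < t ^+ 2 / 2 by rewrite divr_gt0 ?exprn_gt0.
near=> n.
have n0 : (0 < n)%N by near: n; exact: nbhs_infty_gt.
have l01 := hlam01 n n0; have /andP[l0 l1] := l01.
have D0 := ltW (hDelta n n0); have pS := hSigma n n0.
have err1n : (err1 (Sigma n) (Phi n) < (alpha + t)%:E)%E.
  near: n; apply: limn_esup_lt_near; apply: le_lt_trans hlevel _.
  by rewrite lte_fin ltrDl.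
have lam2 : lam n <= 2^-1.
  by near: n; apply: (cvgr_le (0 : R)) => //; rewrite invr_gt0.
have mn : m%:R < n%:R * lam n by near: n; move/cvgryPgt: hnlam; exact.
have e1 : eps n <= 1 by near: n; exact: (cvgr_le _ heps0).
(* Chosen so that [4 / (M / 4) <= t ^+ 2 / 2]; and [1 <= M] gives [M <= M ^+ 2]. *)
pose M := 1 + 32 / t ^+ 2.
have M1 : 1 <= M by rewrite lerDl divr_ge0// sqr_ge0.
have epsM : M <= eps n * Num.sqrt (- ln (lam n)) by near: n; move/cvgryPge: hepslam; exact.
have covn : fine (avg_cov (Sigma n) (lam n) (Delta n) m) <= t ^+ 2 / 2.
  by near: n; exact: (cvgr_le _ hm0).
have hb : ((Delta n)%:E *
       ereal_sup [set (Num.sqrt (sigtilde (Sigma n) I))%:E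
                 | I in intervals (lam n)]
     <= ((Num.sqrt 2 - eps n) * Num.sqrt (- ln (lam n)))%:E)%E by near: n.
pose e := eps n / Num.sqrt 2.
have sl0 : 0 <= Num.sqrt (- ln (lam n)) by exact: sqrtr_ge0.
have eps0 : 0 <= eps n.
  rewrite leNgt; apply/negP => en0.
  have := mulr_le0_ge0 (ltW en0) sl0; lra.
have e01 : 0 <= e <= 1.
  by rewrite divr_ge0 ?(ltW s20)//= ler_pdivrMr// mul1r (le_trans e1).
have hs k : (k < Num.truncn (lam n)^-1)%N ->
    Delta n ^+ 2 * sigtilde (Sigma n) (itv0 (lam n) k) <= 2 * (1 - e) ^+ 2 * - ln (lam n).
  move=> kK; apply: energy_bound => //; first exact: le_trans e1 s2.
  rewrite -lee_fin; apply: le_trans hb; rewrite EFinM lee_wpmul2l ?lee_fin//.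
  by apply: ereal_sup_ubound; exists (itv0 (lam n) k) => //; exact: itv0_interval.
have := finite_sample_bound pS l0 lam2 D0 e01 (ltW t0) hs mn (hPhi n).
set x := e ^+ 2 * _ / 2.
have xM : M / 4 <= x.
  have -> : x = (eps n * Num.sqrt (- ln (lam n))) ^+ 2 / 4.
    rewrite /x /e exprMn exprVn sqr_sqrtr// exprMn sqr_sqrtr ?oppr_ge0 ?ln_le0 ?ltW//.
    by field.
  rewrite ler_pM2r ?invr_gt0//; apply: (le_trans epsM); rewrite expr2 ler_peMl//; lra.
have x0 : 0 < x by lra.
have etan : 4 * expR (- x) <= t ^+ 2 / 2.
  apply: (@le_trans _ _ (4 * (M / 4)^-1)).
    rewrite ler_wpM2l//; apply: (le_trans (expRN_le_inv x0)).
    by rewrite lef_pV2 ?posrE//; lra.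
  rewrite invf_div mulrA ler_pdivrMr; last lra.
  have -> : t ^+ 2 / 2 * M = t ^+ 2 / 2 + 16 by rewrite /M; field; rewrite gt_eqF.
  lra.
have PE : (P0 (Sigma n) [set y | Phi n y = false]) = (1 - err1 (Sigma n) (Phi n))%E.
  rewrite /err1 -probability_setC; last exact: (measurable_decision _ (hPhi n)).
  by congr (P0 _ _); apply/seteqP; split => y /=; case: (Phi n y).
have err1E : err1 (Sigma n) (Phi n) = (fine (err1 (Sigma n) (Phi n)))%:E.
  rewrite fineK// fin_num_measure//.
  exact: (measurable_decision _ (hPhi n)).
have err2E := fineK (err2_fin_num (Sigma n) l01 D0 (hPhi n)).
rewrite PE -err2E err1E -EFinB/= lee_fin; move: err1n; rewrite err1E lte_fin.
move=> err1t; set b := fine (err2 _ _ _ _) => H.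
set p := fine (err1 _ _) in H err1t.
have : t * (1 - p) <= t * (b + 2 * t) by rewrite [leRHS]mulrDr; move: H => /=; lra.
rewrite ler_pM2l// => {}H; rewrite /t in err1t H; lra.
Unshelve. all: by end_near.
Qed.
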